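(* Let $S$ be a cancellative, commutative, Hausdorff, locally compact, $\sigma$-compact topological semigroup with open shifts. Then $S$ has countable cellularity.
   Context: A topological semigroup is a nonempty set $S$ with an associative operation and a topology such that the operation $S\times S\to S$ is jointly continuous. It has open shifts if for every $a\in S$ and every open $U\subseteq S$ the sets $aU$ and $Ua$ are open in $S$. A space is locally compact if each point has a compact neighborhood, and $\sigma$-compact if it is a countable union of compact subsets. A cellular family in a space $X$ is a nonempty pairwise disjoint family of nonempty open sets in $X$; the cellularity is $c(X)=\sup\{|\mathcal U|:\mathcal U\text{ is a cellular family in }X\}+\aleph_0$, and $X$ has countable cellularity if $c(X)=\aleph_0$. *)

(* Defs.v *)
From HB Require Import structures.
From mathcomp Require Import all_boot all_classical topology.

Set Implicit Arguments.
Unset Strict Implicit.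
Unset Printing Implicit Defensive.

Local Open Scope classical_set_scope.
Local Open Scope card_scope.
Local Open Scope group_scope.

HB.mixin Record isTopologicalSemigroup S of Topological S & Semigroup S := {
  topsemigroup_nonempty : [set: S] !=set0;
  mulg_continuous : continuous (fun z : S * S => z.1 * z.2)
}.

#[short(type="topologicalSemigroupType")]
HB.structure Definition TopologicalSemigroup :=
  {S of Topological S & Semigroup S & isTopologicalSemigroup S}.

Definition cancellative (S : semigroupType) : Prop :=
  right_injective (fun x y : S => x * y) /\
  left_injective (fun x y : S => x * y).

Definition open_shifts (S : topologicalSemigroupType) : Prop :=
  forall (a : S) (U : set S), open U ->
    open [set a * x | x in U] /\ open [set x * a | x in U].

Definition sigma_compact (X : topologicalType) : Prop :=
  exists K : nat -> set X,
    (forall n, compact (K n)) /\ \bigcup_n K n = [set: X].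

(* MathComp-Analysis' [locally_compact] asks for compact neighborhoods that are
   moreover closed; in a Hausdorff space this is no restriction. *)
Lemma locally_compact_hausdorffE (X : topologicalType) :
  hausdorff_space X ->
  locally_compact [set: X] <->
  forall x : X, exists2 K : set X, nbhs x K & compact K.
Proof.
move=> hX; split=> lcX x.
  have [K + [cK _]] := lcX x I; rewrite withinET => xK; by exists K.
move=> _; have [K xK cK] := lcX x; exists K; first by rewrite withinET.
by split=> //; exact: compact_closed.
Qed.

Definition cellular_family (X : topologicalType) (F : set (set X)) : Prop :=
  [/\ F !=set0, forall U, F U -> open U /\ U !=set0 & trivIset F id].

(* Cardinal numbers are represented by arbitrary sets, compared by [#<=] and
   [#=]: [B] has the least cardinality bounding those of all members of [C]. *)
Definition is_card_sup (T : Type) (C : set (set T)) (V : Type) (B : set V) :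
    Prop :=
  (forall A, C A -> A #<= B) /\
  forall (W : Type) (D : set W), (forall A, C A -> A #<= D) -> B #<= D.

Definition card_sum (V W : Type) (B : set V) (D : set W) : set (V + W) :=
  [set inl x | x in B] `|` [set inr y | y in D].

(* The cardinal c(X) is that of [K]. *)
Definition is_cellularity (X : topologicalType) (T : Type) (K : set T) : Prop :=
  exists (V : Type) (B : set V),
    is_card_sup [set F | @cellular_family X F] B /\
    K #= card_sum B [set: nat].

Definition countable_cellularity (X : topologicalType) : Prop :=
  is_cellularity X [set: nat].

(* Main.v *)
Require Import Defs.
From HB Require Import structures.
From mathcomp Require Import all_boot all_classical topology.
From mathcomp Require finmap.

(** A sigma-compact locally compact group has a sigma-finite Haar measure that
    charges every nonempty open set, so its cellular families are countable.
    The proof below carries out this argument inside [S], with finite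
    combinatorics in place of both the group of quotients and the measure.

    Fix a point [a] of [S]; in the group of quotients, a neighborhood [W] of
    [a] is the shift by [a] of a neighborhood [W / a] of the identity.  The
    size of a set [A], measured at the scale [W], is the largest number of
    points of [A] whose shifts [x * W] are pairwise disjoint ([packing]).  This
    packing number behaves like an invariant measure:
    - it is finite on compact sets ([compact_packing_le]);
    - it is subadditive and invariant under translations, so that a compact
      set [C] is at most [N] times as large as a given neighborhood [V], with
      [N] independent of the scale [W] ([compact_packing_le_mul]);
    - it is superadditive on sets [V U] such that the sets [V U * W] lie in
      the shifts [a * U] of pairwise disjoint sets [U] ([ample_packing]).

    By joint continuity at [(x, a)], every open [U] that meets the interior of
    a compact set [C] at [x] contains such a [V U] for all small enough scales
    [W], and [V U] has at least one [N]-th of the size of [C] ([ample]).  For a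
    given [N], among pairwise disjoint sets there are at most [N] of this kind
    ([size_ample]): a scale [W] can be chosen that suits finitely many of them
    at once.  As [S] is covered by the interiors of countably many compact
    sets, a cellular family is a countable union of finite families. *)

Local Open Scope card_scope.
Local Open Scope classical_set_scope.
Local Open Scope group_scope.

(** * Compact sets *)

(** Compactness is used in its near-covering form, for the filter generated by
    the sets of finite sequences that contain a given one: near [x], the
    sequences containing [x] eventually cover, hence some sequence covers all
    of [A].  This form does not depend on a base point of [X]. *)
Lemma compact_finite_subcover {X : topologicalType} {A : set X}
    {B : X -> set X} :
  compact A -> (forall x, A x -> nbhs x (B x)) ->
  exists r : seq X, forall x, A x -> exists2 y, y \in r & B y x.
Proof.
move=> /compact_near_coveringP cA nB.
pose F (Q : set (seq X)) := exists r0 : seq X, forall r, {subset r0 <= r} -> Q r.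
have FF : Filter F.
  split; first by exists [::].
  - move=> P Q [r1 P1] [r2 Q2]; exists (r1 ++ r2) => r sr.
    by split; [apply: P1|apply: Q2] => x xr; apply: sr; rewrite mem_cat xr ?orbT.
  - by move=> P Q PQ [r0 P0]; exists r0 => r /P0/PQ.
have [|r0 r0P] := cA _ F (fun r x => exists2 y, y \in r & B y x) FF.
  move=> x Ax; exists (B x, [set r : seq X | x \in r]).
    split; first exact: nB.
    by exists [:: x] => r; apply; rewrite inE.
  by case=> y r /= [By xr]; exists x.
by exists r0; exact: r0P.
Qed.

Lemma compact_exhaustion {X : topologicalType} :
  locally_compact [set: X] -> sigma_compact X ->
  exists C : nat -> set X,
    (forall n, compact (C n)) /\ \bigcup_n (C n)° = [set: X].
Proof.
move=> lcX [K [cK KT]].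
have /choice[L LP] : forall x : X, exists L, nbhs x L /\ compact L.
  move=> x; have [L + [cL _]] := lcX x I.
  by rewrite withinET => xL; exists L.
have /choice[r rP] : forall n, exists r : seq X, forall x, K n x ->
    exists2 y, y \in r & (L y)° x.
  move=> n; apply: (compact_finite_subcover (cK n)) => x _.
  by apply: nbhs_interior; case: (LP x).
exists (fun n => \big[setU/set0]_(y <- r n) L y); split.
  by move=> n; apply: bigsetU_compact => y _; case: (LP y).
apply/seteqP; split=> // x _.
have [n _ Knx] : (\bigcup_n K n) x by rewrite KT.
exists n => //; have [y yr] := rP n x Knx.
by apply: interiorS => z Lz; rewrite -bigcup_seq; exists y.
Qed.

(** * Neighborhoods in a topological semigroup *)

Lemma mulg_nbhs {S : topologicalSemigroupType} {x y : S} {O : set S} :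
  nbhs (x * y) O ->
  exists V W, [/\ nbhs x V, nbhs y W & forall v w, V v -> W w -> O (v * w)].
Proof.
move=> /(mulg_continuous (x, y)) [[V W] /= [xV yW] VW].
by exists V, W; split=> // v w Vv Ww; exact: (VW (v, w)).
Qed.

Lemma nbhs_mulgr {S : topologicalSemigroupType} {x y : S} {O : set S} :
  nbhs (x * y) O -> nbhs x [set v | O (v * y)].
Proof.
move=> /mulg_nbhs[V [W [xV /nbhs_singleton Wy VW]]].
by apply: filterS xV => v Vv; exact: VW.
Qed.

Lemma nbhs_shift {S : topologicalSemigroupType} (c : S) {x : S} {V : set S} :
  open_shifts S -> nbhs x V -> nbhs (c * x) [set c * v | v in V].
Proof.
move=> Sop; rewrite nbhsE => -[O [oO Ox] OV].
apply: (@filterS _ _ _ [set c * v | v in O]); first exact: image_subset.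
by apply: open_nbhs_nbhs; split; [case: (Sop c O oO)|exists x].
Qed.

(** * Packing numbers *)

Definition packing {S : semigroupType} (W A : set S) (s : seq S) : Prop :=
  [/\ uniq s, [set` s] `<=` A &
      trivIset [set` s] (fun x => [set x * w | w in W])].

(** The packing number of [A] at the scale [W] is at most [k].  Bounds are used
    instead of the number itself, which is infinite for some [A]. *)
Definition packing_le {S : semigroupType} (W A : set S) (k : nat) : Prop :=
  forall s, packing W A s -> (size s <= k)%N.

Section Packing.
Context {S : semigroupType}.
Implicit Types (W A B V C : set S) (s t : seq S).

Lemma packingS {W A B s} : A `<=` B -> packing W A s -> packing W B s.
Proof. by move=> AB [us sA tW]; split=> // x /sA/AB. Qed.

Lemma packing_filter {W A s} B :
  packing W A s -> packing W (A `&` B) [seq x <- s | `[< B x >]].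
Proof.
move=> [us sA tW]; split; first exact: filter_uniq.
  by move=> x /=; rewrite mem_filter => /andP[/asboolP Bx /sA Ax].
by move=> x y /=; rewrite !mem_filter => /andP[_ xs] /andP[_ ys]; exact: tW.
Qed.

Lemma packing_cat {W A B s t} : W !=set0 ->
  (forall x y, A x -> B y ->
    [set x * w | w in W] `&` [set y * w | w in W] = set0) ->
  packing W A s -> packing W B t -> packing W (A `|` B) (s ++ t).
Proof.
move=> [w0 Ww0] AB [us sA tWs] [ut tB tWt]; split.
- rewrite cat_uniq us ut andbT; apply/hasPn => x /tB Bx; apply/negP => /sA Ax.
  have : ([set x * w | w in W] `&` [set x * w | w in W]) (x * w0).
    by split; exists w0.
  by rewrite AB.
- by move=> x /=; rewrite mem_cat => /orP[/sA|/tB]; [left|right].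
move=> x y /=; rewrite !mem_cat => /orP[xs|xt] /orP[ys|yt].
- exact: tWs.
- by rewrite AB => [[]||] //; [exact: sA|exact: tB].
- by rewrite setIC AB => [[]||] //; [exact: sA|exact: tB].
- exact: tWt.
Qed.

(** Subadditivity: the points of a packing of [A] that lie in one piece form a
    packing of that piece. *)
Lemma packing_le_cover {I : eqType} (r : seq I) (B : I -> set S) {W A k} :
  (forall x, A x -> exists2 i, i \in r & B i x) ->
  (forall i, packing_le W (B i) k) -> packing_le W A (size r * k).
Proof.
move=> + Bk; elim: r A => [|i r IH] A AB s ps.
  by case: s ps => // x s [_ /(_ x (mem_head _ _)) /AB[]].
rewrite -(count_predC (fun x => `[< B i x >])) -!size_filter mulSn leq_add //.
  by apply/(Bk i)/(packingS (B := B i)); last exact: packing_filter ps => x [].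
have := packing_filter (~` B i) ps.
rewrite (@eq_filter _ (fun x => `[< (~` B i) x >])
  (predC (fun x => `[< B i x >]))); last by move=> x; rewrite /= asbool_neg.
apply: IH => x [/AB[j + Bj] nB]; rewrite inE => /predU1P[ji|jr].
  by rewrite -ji in nB.
by exists j.
Qed.

Lemma packing_max {W A k} :
  packing_le W A k -> exists2 s, packing W A s & packing_le W A (size s).
Proof.
move=> Ak; pose P n := `[< exists2 s, packing W A s & size s = n >].
have P0 : exists n, P n.
  by exists 0%N; apply/asboolP; exists [::] => //; split.
have Pk n : P n -> (n <= k)%N by move=> /asboolP[s /Ak + <-].
case: (ex_maxnP P0 Pk) => m /asboolP[s ps <-] sm; exists s => // t pt.
by apply: sm; apply/asboolP; exists t.
Qed.

(** Translation invariance: the set in the conclusion stands for the translate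
    [u^-1 * t * V] in the group of quotients.  Its points [c] correspond to
    points [v] of [V] through [u * c = t * v], and cancelling [u] shows that
    [v * W] and [v' * W] are disjoint if [c * W] and [c' * W] are. *)
Lemma packing_le_translate (u t : S) {W V k} : cancellative S ->
  packing_le W V k -> packing_le W [set c | [set t * v | v in V] (u * c)] k.
Proof.
move=> [cancl _] Vk s [us sA tW].
have /choice[f fP] : forall c, exists v,
    c \in s -> V v /\ t * v = u * c.
  move=> c; have [/sA[v Vv tv]|ncs] := boolP (c \in s).
    by exists v.
  by exists c.
rewrite -(size_map f); apply: Vk; split.
- rewrite map_inj_in_uniq // => x y xs ys fxy; apply: (cancl u).
  by rewrite -(fP x xs).2 -(fP y ys).2 fxy.
- by move=> x /= /mapP[c cs ->]; exact: (fP c cs).1.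
move=> _ _ /= /mapP[c cs ->] /mapP[d ds ->] [z [[w Ww <-] [w' Ww' E]]].
congr f; apply: tW => //; exists (c * w); split; first by exists w.
exists w' => //; apply: (cancl u).
by rewrite !mulgA -(fP c cs).2 -(fP d ds).2 -!mulgA E.
Qed.

End Packing.

(** * Packing numbers and the topology *)

Section Shifts.
Context {S : topologicalSemigroupType}.
Hypothesis S_cancel : cancellative S.
Hypothesis S_comm : commutative (fun x y : S => x * y).
Hypothesis S_shifts : open_shifts S.
Implicit Types (a : S) (W V C U : set S).

(** Two points [b] and [b'] close enough to [c] satisfy [b * a = c * w] and
    [b' * a = c * w'] with [w] and [w'] in [W].  By commutativity
    [b * w' * a = c * w * w' = b' * w * a], hence [b * w' = b' * w] and the
    shifts [b * W] and [b' * W] meet.  So [c] has a neighborhood of packing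
    number at most one, and finitely many of these cover [C].  Commutativity
    replaces here the continuity of the inverse. *)
Lemma compact_packing_le {a W C} : nbhs a W -> compact C ->
  exists k, packing_le W C k.
Proof.
move=> aW cC; pose B c := [set b | [set c * w | w in W] (b * a)].
have nB c : C c -> nbhs c (B c).
  by move=> _; exact/nbhs_mulgr/nbhs_shift.
have [r rP] := compact_finite_subcover cC nB.
exists (size r * 1)%N; apply: (packing_le_cover r B rP) => c.
case=> [|b [|b' s]] // [/= /andP[+ _] sB tW].
rewrite inE negb_or => /andP[/eqP nbb' _].
have [|w Ww E] := sB b; first by rewrite /= inE eqxx.
have [|w' Ww' E'] := sB b'; first by rewrite /= !inE eqxx orbT.
case: nbb'; apply: tW; rewrite /= ?inE ?eqxx ?orbT //.
exists (b * w'); split; first by exists w'.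
exists w => //; apply: (S_cancel.2 a).
by rewrite /= -!mulgA (S_comm w) (S_comm w') !mulgA -E -E' -!mulgA (S_comm w).
Qed.

(** Each point [c] of [C] lies in the open translate [v^-1 * c * V] of [V], as
    [v * c = c * v]; [N] is the length of a finite subcover. *)
Lemma compact_packing_le_mul {v : S} {C V} : nbhs v V -> compact C ->
  exists N, forall W k, packing_le W V k -> packing_le W C (N * k).
Proof.
move=> vV cC; pose B c := [set b | [set c * w | w in V] (v * b)].
have nB c : C c -> nbhs c (B c).
  move=> _; have := nbhs_shift c S_shifts vV.
  move=> /nbhs_mulgr; apply: filterS => b; by rewrite /B /= (S_comm b).
have [r rP] := compact_finite_subcover cC nB.
exists (size r) => W k Vk; apply: (packing_le_cover r B rP) => c.
exact: packing_le_translate.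
Qed.

(** The part [V] of [C] has at least one [N]-th of the size of [C] at every
    scale, and at scales included in [O] a packing of [V] stays, shifts
    included, within [a * U]: this is what keeps packings that belong to
    disjoint sets [U] from interfering. *)
Definition ample a C (N : nat) U : Prop := exists V O,
  [/\ V `<=` C, nbhs a O,
      forall v w, V v -> O w -> [set a * u | u in U] (v * w) &
      forall W k, packing_le W V k -> packing_le W C (N * k)].

Lemma open_ample a {C U} : compact C -> open U -> U `&` C° !=set0 ->
  exists N, ample a C N U.
Proof.
move=> cC oU [x [Ux Cx]].
have := nbhs_shift a S_shifts (open_nbhs_nbhs (conj oU Ux)).
rewrite (S_comm a) => /mulg_nbhs[V [O [xV aO VO]]].
have [N NP] := compact_packing_le_mul (filterI xV Cx) cC.
by exists N, (V `&` C), O; split=> // v w [Vv _]; exact: VO.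
Qed.

(** Superadditivity: if [v * W] is included in [a * U] for [v] in [V U], then
    packings of the various [V U] can be put together, because the [a * U] are
    pairwise disjoint. *)
Lemma ample_packing {a N W} {s : seq S} {r : seq (set S)}
    {V : set S -> set S} : W !=set0 -> uniq r -> trivIset [set` r] id ->
  (forall U v w, U \in r -> V U v -> W w -> [set a * u | u in U] (v * w)) ->
  (forall U, U \in r ->
    exists2 t, packing W (V U) t & (size s <= N * size t)%N) ->
  exists2 t, packing W (\bigcup_(U in [set` r]) V U) t &
    (size r * size s <= N * size t)%N.
Proof.
move=> W0 + + + rs; elim: r rs => [|U r IH] rs /=.
  by move=> _ _ _; exists [::] => //; split.
move=> /andP[Ur ur] tr VW.
have rUr U' : U' \in r -> U' \in U :: r by rewrite inE orbC => ->.
have [|||U' v w U'r|t pt ts] := IH.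
- by move=> U' /rUr/rs.
- exact: ur.
- by move=> U1 U2 /= /rUr r1 /rUr r2; exact: tr.
- by apply: VW; exact: rUr.
have [t' pt' t's] := rs U (mem_head _ _).
exists (t' ++ t); last by rewrite size_cat mulnDr mulSn leq_add.
apply: (@packingS _ _ (V U `|` \bigcup_(U' in [set` r]) V U')).
  move=> v [Vv|[U' /= U'r Vv]]; first by exists U; rewrite //= mem_head.
  by exists U' => //=; exact: rUr.
apply: packing_cat => // x y Vx [U' U'r Vy].
apply/seteqP; split=> // z [[w Ww <-] [w' Ww' E]].
have [u Uu Eu] := VW U x w (mem_head _ _) Vx Ww.
have [u' Uu' Eu'] := VW U' y w' (rUr _ U'r) Vy Ww'.
have UU' : U = U'.
  apply: tr; rewrite /= ?mem_head ?rUr //; exists u; split=> //.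
  by rewrite (_ : u = u') //; apply: (S_cancel.1 a); rewrite /= Eu Eu' E.
by move: Ur; rewrite UU' U'r.
Qed.

(** If [P] is the size of a maximal packing of [C], then each of the [size r]
    sets contributes a packing of size at least [P / N]; put together they form
    a packing of [C], so [size r * (P / N) <= P]. *)
Lemma size_ample {a C N} {r : seq (set S)} : compact C -> C !=set0 ->
  uniq r -> trivIset [set` r] id -> (forall U, U \in r -> ample a C N U) ->
  (size r <= N)%N.
Proof.
move=> cC [c Cc] ur tr rA.
have /choice[f fP] : forall U, exists VO : set S * set S, U \in r ->
  [/\ VO.1 `<=` C, nbhs a VO.2,
      forall v w, VO.1 v -> VO.2 w -> [set a * u | u in U] (v * w) &
      forall W k, packing_le W VO.1 k -> packing_le W C (N * k)].
  move=> U; have [/rA[V [O VO]]|_] := boolP (U \in r).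
    by exists (V, O).
  by exists (set0, set0).
(* A common scale for the finitely many members of [r]. *)
pose W := \bigcap_(U in [set` r]) (f U).2.
have aW : nbhs a W.
  rewrite /W; elim: (r) (fun U Ur => let: And4 _ h _ _ := fP U Ur in h).
    by move=> _; apply: filterS filterT => x _ U.
  move=> U r' IH h.
  apply: (@filterS _ _ _ ((f U).2 `&` \bigcap_(U in [set` r']) (f U).2)).
    by move=> x [Ux r'x] U' /=; rewrite inE => /predU1P[->|/r'x].
  apply: filterI; first by apply: h; rewrite mem_head.
  by apply: IH => U' U'r; apply: h; rewrite inE U'r orbT.
have W0 : W !=set0 by exists a; exact: nbhs_singleton.
have [k Ck] := compact_packing_le aW cC.
have [s ps Cs] := packing_max Ck.
(* A single point of [C] is a packing. *)
have s0 : (0 < size s)%N.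
  apply: (Cs [:: c]); split=> //.
    by move=> x /=; rewrite inE => /eqP ->.
  by move=> x y /=; rewrite !inE => /eqP -> /eqP ->.
have [|U Ur|t pt ts] := @ample_packing a N W s r (fst \o f) W0 ur tr.
- move=> U v w Ur Vv Ww; have [_ _ VO _] := fP U Ur.
  by apply: VO => //; exact: Ww.
- have [VC _ _ VN] := fP U Ur.
  have [|t pt Vt] := @packing_max _ W (f U).1 (size s).
    by move=> t /(packingS VC) /Cs.
  by exists t => //; exact: VN ps.
rewrite -(leq_pmul2r s0) (leq_trans ts) // leq_mul2l Cs ?orbT //.
by apply: packingS pt => x [U /= Ur]; have [VC _ _ _] := fP U Ur; exact: VC.
Qed.

Lemma cellular_family_countable {F : set (set S)} :
  locally_compact [set: S] -> sigma_compact S ->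
  cellular_family F -> countable F.
Proof.
move=> lcS scS [_ oF tF]; have [a _] := @topsemigroup_nonempty S.
have [C [cC CT]] := compact_exhaustion lcS scS.
(* The compact set [C n] has to be nonempty for [size_ample] to apply. *)
pose G n N := [set U | [/\ F U, C n !=set0 & ample a (C n) N U]].
have finG n N : finite_set (G n N).
  apply: contrapT => /(infinite_set_fset N.+1)[B BG].
  have {BG} : forall U, U \in finmap.enum_fset B -> G n N U by move=> U /BG.
  move: (finmap.enum_fset B) (finmap.fset_uniq B) => r ur rG.
  have [C0|nC0] := pselect (C n !=set0).
    rewrite ltnNge => /negP; apply.
    apply: (size_ample (a := a) (cC n) C0 ur) => [|U /rG[_ _]] //.
    by move=> U V /rG[FU _ _] /rG[FV _ _]; exact: tF.
  by case: r rG {ur} => // U r /(_ U (mem_head _ _))[].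
apply: (@sub_countable _ _ _ (\bigcup_n \bigcup_N G n N)).
  apply: subset_card_le => U FU; have [oU [x Ux]] := oF U FU.
  have [n _ Cx] : (\bigcup_n (C n)°) x by rewrite CT.
  have [N UN] := open_ample a (cC n) oU (ex_intro _ x (conj Ux Cx)).
  exists n => //; exists N => //; split=> //.
  by exists x; exact: interior_subset Cx.
apply: bigcup_countable => // n _; apply: bigcup_countable => // N _.
exact: finite_set_countable.
Qed.

End Shifts.

(** * Suprema of countable cardinals *)

(** The supremum is the least finite bound if there is a finite bound, and
    otherwise it is the cardinal of [nat], since a set that dominates all
    members of [C] is then infinite. *)
Lemma card_sup_countable {T : Type} (C : set (set T)) :
  (forall A, C A -> countable A) -> exists B : set nat, is_card_sup C B.
Proof.
move=> Cc.
have [bC|nbC] := pselect (exists n, forall A, C A -> A #<= `I_n).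
  pose P n := `[< forall A, C A -> A #<= `I_n >].
  have P0 : exists n, P n by have [n nP] := bC; exists n; exact/asboolP.
  case: (ex_minnP P0) => n /asboolP Cn nmin; exists `I_n; split=> // V D CD.
  have [/finite_setP[m Dm]|/infiniteP] := pselect (finite_set D); last first.
    exact/card_le_trans/card_leT.
  rewrite (card_le_eqr Dm) card_le_II; apply: nmin; apply/asboolP => A /CD.
  by rewrite (card_le_eqr Dm).
exists [set: nat]; split=> [A /Cc //|V D CD]; apply/infiniteP.
move=> /finite_setP[m Dm]; apply: nbC; exists m => A /CD.
by rewrite (card_le_eqr Dm).
Qed.

Lemma card_sum_nat (B : set nat) : [set: nat] #= Defs.card_sum B [set: nat].
Proof.
rewrite card_eq_sym; apply: eq_card_nat; first exact: countableP.
apply/infiniteP/(@card_le_trans _ _ _ (@inr nat nat @` [set: nat])).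
  have inr_inj : {in [set: nat] &, injective (@inr nat nat)} by move=> m n _ _ [].
  by rewrite (card_le_eqr (inj_card_eq inr_inj)).
by apply: subset_card_le => y; right.
Qed.

Theorem theorem4p1 (S : topologicalSemigroupType)
    (S_cancel : cancellative S)
    (S_comm : commutative (fun x y : S => x * y))
    (S_hausdorff : hausdorff_space S)
    (S_lcompact : locally_compact [set: S])
    (S_scompact : sigma_compact S)
    (S_shifts : open_shifts S) :
  countable_cellularity S.
Proof.
have [F FF|B supB] := @card_sup_countable _ [set F | @cellular_family S F].
  exact: (cellular_family_countable S_cancel S_comm S_shifts).
by exists nat, B; split; last exact: card_sum_nat.
Qed.
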